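(* Let $(\Omega,\mu)$ be a measure space with positive measure $\mu$, $H$ a separable Hilbert space, $\{H_\omega\}_{\omega\in\Omega}$ a family of Hilbert spaces, and $K\in B(H)$. Let $\{\Lambda_\omega\}_{\omega\in\Omega}$ be a c-K-g-frame for $H$ with respect to $\{H_\omega\}_{\omega\in\Omega}$ with bounds $A,B$, and let $\{\Gamma_\omega\in B(H,H_\omega):\omega\in\Omega\}$ be a family of operators such that $\{\Gamma_\omega f\}_{\omega\in\Omega}$ is strongly measurable for each $f\in H$. If there exist constants $\lambda_1,\lambda_2,\gamma\ge 0$ such that $\max\{\lambda_2,\frac{\gamma}{A}+\lambda_1\}<1$ and, for each $f,g\in H$, $$\int_\Omega\big|\langle(\Lambda_\omega^*\Lambda_\omega-\Gamma_\omega^*\Gamma_\omega)f,g\rangle\big|\,d\mu(\omega)\le\lambda_1\int_\Omega\big|\langle\Lambda_\omega^*\Lambda_\omega f,g\rangle\big|\,d\mu(\omega)+\lambda_2\int_\Omega\big|\langle\Gamma_\omega^*\Gamma_\omega f,g\rangle\big|\,d\mu(\omega)+\gamma\|K^*f\|^2,$$ then $\{\Gamma_\omega\}_{\omega\in\Omega}$ is a c-K-g-frame for $H$ with respect to $\{H_\omega\}_{\omega\in\Omega}$ with bounds $$\frac{(1-\lambda_1)A-\gamma}{1+\lambda_2}\quad\text{and}\quad\frac{(1+\lambda_1)B+\gamma\|K\|^2}{1-\lambda_2}.$$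
   Context: $B(H,H')$ denotes the bounded linear operators from $H$ to $H'$, and $B(H)=B(H,H)$. Let $\prod_{\omega\in\Omega}H_\omega=\{f:\Omega\to\cup_{\omega\in\Omega}H_\omega:\ f(\omega)\in H_\omega\}$. An element $F\in\prod_{\omega\in\Omega}H_\omega$ is strongly measurable if $F$, as a mapping of $\Omega$ to $\oplus_{\omega\in\Omega}H_\omega$ (each $H_\omega$ viewed as the $\omega$-th summand), is measurable. For $K\in B(H)$, a family $\{\Lambda_\omega\in B(H,H_\omega):\omega\in\Omega\}$ is a c-K-g-frame (continuous K-g-frame) for $H$ with respect to $\{H_\omega\}_{\omega\in\Omega}$ if (i) for each $f\in H$, $\{\Lambda_\omega f\}_{\omega\in\Omega}$ is strongly measurable; (ii) there exist constants $0<A\le B<\infty$ such that $A\|K^*f\|^2\le\int_\Omega\|\Lambda_\omega f\|^2d\mu(\omega)\le B\|f\|^2$ for all $f\in H$. The constants $A$ and $B$ are called the lower and upper c-K-g-frame bounds, respectively.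
   Formalization: The right-hand side of the displayed inequality is also assumed finite for all f, g; otherwise the claim fails (e.g. H = H_n = C, K = Λ_n = 1, Γ_n = 2^n, μ{n} = 2^{-(n+1)}, λ2 = 1/2, λ1 = γ = 0, where both sides are infinite). *)

(* Defs.v *)
From HB Require Import structures.
From mathcomp Require Import all_boot all_order all_algebra.
From mathcomp Require Import complex.
From mathcomp Require Import all_classical all_reals all_analysis.

Set Implicit Arguments.
Unset Strict Implicit.
Unset Printing Implicit Defensive.

Import Order.TTheory GRing.Theory Num.Theory.
Import numFieldNormedType.Exports.

Local Open Scope classical_set_scope.
Local Open Scope ring_scope.

(* Norms over R[i] take values in R[i]; this is the same norm read in R.      *)
Definition rnorm (R : realType) (V : normedZmodType R[i]) (x : V) : R :=
  complex.Re `|x|.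

(* Complex Hilbert spaces: complete normed spaces whose norm comes from an    *)
(* inner product. {dot V for Num.conj} is linear in its first argument and    *)
(* conjugate-linear in its second one.                                        *)
HB.mixin Record CompleteNormedModule_isHilbert (R : realType) V
    of CompleteNormedModule R[i] V := {
  inner : {dot V for (@Num.conj R[i])};
  inner_normE : forall x : V, inner x x = `|x| ^+ 2
}.

#[short(type="hilbertType")]
HB.structure Definition Hilbert (R : realType) :=
  {V of CompleteNormedModule R[i] V & CompleteNormedModule_isHilbert R V}.

Definition separable_space (T : topologicalType) :=
  exists2 D : set T, countable D & dense D.

Record bounded_op (R : realType) (U V : hilbertType R) := BoundedOp {
  bounded_op_fun :> {linear U -> V};
  bounded_opP : bounded_near bounded_op_fun (nbhs (0 : U))
}.

Notation "''B' ( U , V )" := (bounded_op U V) (format "''B' ( U ,  V )").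

Section operators.
Context {R : realType} {U V : hilbertType R}.

(* The adjoint is the unique map g such that <f x, y> = <x, g y>; it exists   *)
(* by the Riesz representation theorem, so the default value is never used.   *)
Definition adjoint (f : 'B(U, V)) : V -> U :=
  xget (fun=> 0) [set g : V -> U | forall x y, inner (f x) y = inner x (g y)].

Definition op_norm (f : 'B(U, V)) : R :=
  sup [set rnorm (f x) | x in [set x : U | rnorm x <= 1]].

End operators.

Section direct_sum.
Context {R : realType} {I : choiceType} (H : I -> hilbertType R).

Definition sqnorm_sum (x : forall i, H i) : \bar R :=
  \esum_(i in [set: I]) (rnorm (x i) ^+ 2)%:E.

(* The l^2 direct sum; hdsum_open is the topology of its norm.                *)
Definition hdsum := {x : forall i, H i | (sqnorm_sum x < +oo)%E}.

Definition hdsum_open (A : set hdsum) :=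
  forall x, A x -> exists2 e : R, 0 < e & forall y : hdsum,
    (sqnorm_sum (fun i => (sval y i - sval x i)%R) < (e ^+ 2)%:E)%E -> A y.

Definition summand_fun (i : I) (v : H i) : forall j, H j :=
  dfwith (fun j => 0 : H j) i v.

Lemma summand_fun_summable i (v : H i) : (sqnorm_sum (summand_fun v) < +oo)%E.
Proof.
rewrite /sqnorm_sum.
have -> : (fun j => (rnorm (summand_fun v j) ^+ 2)%:E) =
    (fun j => if j \in [set i] then (rnorm (summand_fun v j) ^+ 2)%:E else 0%E).
  apply/funext => j; case: ifPn => //; rewrite notin_setE => /= ji.
  by rewrite /summand_fun dfwithout ?/rnorm ?normr0 ?expr0n// eq_sym; apply/eqP.
rewrite -esum_mkcond esum_set1 ?ltry// lee_fin sqr_ge0//.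
Qed.

Definition summand (i : I) (v : H i) : hdsum :=
  exist _ (summand_fun v) (summand_fun_summable v).

End direct_sum.

Section frames.
Context {R : realType} {d : measure_display} {Omega : measurableType d}.
Variables (H_ : Omega -> hilbertType R).

(* Measurability of w |-> F w as a map from Omega to the direct sum, each H_ w *)
(* being viewed as the w-th summand.                                          *)
Definition strongly_measurable (F : forall w, H_ w) :=
  forall A : set (hdsum H_), hdsum_open A ->
    measurable [set w | A (summand (F w))].

Definition c_K_g_frame (mu : {measure set Omega -> \bar R}) (H : hilbertType R)
    (K : 'B(H, H)) (L : forall w, 'B(H, H_ w)) (A B : R) :=
  [/\ forall f : H, strongly_measurable (fun w => L w f),
      0 < A, A <= B &
      forall f : H,
        ((A * rnorm (adjoint K f) ^+ 2)%:E
           <= \int[mu]_w (rnorm (L w f) ^+ 2)%:E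
           <= (B * rnorm f ^+ 2)%:E)%E].

End frames.

(* Main.v *)
Require Import Defs.
From mathcomp Require Import all_boot all_order all_algebra.
From mathcomp Require Import complex.
From mathcomp Require Import all_classical all_reals all_analysis.
From mathcomp Require Import measurable_realfun.
From mathcomp Require Import ring lra.

Set Implicit Arguments.
Unset Strict Implicit.
Unset Printing Implicit Defensive.

Import Order.TTheory GRing.Theory Num.Theory.
Import numFieldNormedType.Exports.

Local Open Scope classical_set_scope.
Local Open Scope ring_scope.

(** Taking g = f, the form of Lambda_w^* Lambda_w at (f, f) is the nonnegative
    number |Lambda_w f|^2, and likewise for Gamma. Writing a and b for the
    integrals of |Lambda_w f|^2 and |Gamma_w f|^2, and D for the integral of
    the absolute value of their difference, the hypothesis reads
      D <= lambda1 a + lambda2 b + gamma |K^* f|^2,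
    while the triangle inequality gives a - b <= D and b - a <= D. As D and
    a <= B |f|^2 are finite, so is b, and the inequalities rearrange to
      (1 - lambda1) a - gamma |K^* f|^2 <= (1 + lambda2) b,
      (1 - lambda2) b <= (1 + lambda1) a + gamma |K^* f|^2
    ([integral_perturbation]). The frame inequalities for Lambda and
    |K^* f| <= |K| |f| then give the two bounds.

    Two points need preparation. The computation with adjoints uses that they
    exist ([adjointP]), which is the Riesz representation theorem. It is proved
    here for real functionals and the real part of the inner product
    ([riesz_real]), by minimising |x|^2 - 2 phi x; complex linearity recovers
    the full inner product. Splitting integrals uses that w |-> |Gamma_w f| is
    measurable ([measurable_rnorm]): strong measurability speaks of open sets
    of the direct sum, and the vectors having some coordinate of norm above c
    form such a set. *)

(** * The real inner product of a complex Hilbert space *)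
Lemma Re_add (R : realType) (z w : R[i]) :
  complex.Re (z + w) = complex.Re z + complex.Re w.
Proof. by case: z w => ? ? []. Qed.

Lemma Re_scale (R : realType) (t : R) (z : R[i]) :
  complex.Re (t%:C%C * z) = t * complex.Re z.
Proof. by case: z => a b /=; rewrite mul0r subr0. Qed.

Section RealInner.
Context {R : realType} {V : hilbertType R}.
Implicit Types (x y z : V) (t : R).

Definition rdot x y : R := complex.Re (inner x y).

Lemma rnorm_complex x : (rnorm x)%:C%C = `|x|.
Proof. by rewrite /rnorm RRe_real// normr_real. Qed.

Lemma rnorm_ge0 x : 0 <= rnorm x.
Proof. by rewrite -lecR rnorm_complex normr_ge0. Qed.

Lemma inner_self x : inner x x = (rnorm x ^+ 2)%:C%C.
Proof. by rewrite inner_normE -rnorm_complex rmorphXn. Qed.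

Lemma rdot_self x : rdot x x = rnorm x ^+ 2.
Proof. by rewrite /rdot inner_self. Qed.

Lemma rdotC x y : rdot x y = rdot y x.
Proof.
rewrite /rdot hermC expr0 mul1r.
by apply: complexI; rewrite !complexRe Re_conj.
Qed.

Lemma innerBl x y z : inner (x - y) z = inner x z - inner y z.
Proof. exact: linearBl. Qed.

Lemma rdotDl x y z : rdot (x + y) z = rdot x z + rdot y z.
Proof. by rewrite /rdot linearDl Re_add. Qed.

Lemma rdotZl t x z : rdot (t%:C%C *: x) z = t * rdot x z.
Proof.
by rewrite /rdot linearZl_LR /= Re_scale.
Qed.

Lemma rdotDr x y z : rdot z (x + y) = rdot z x + rdot z y.
Proof. by rewrite rdotC rdotDl !(rdotC z). Qed.

Lemma rdotZr t x z : rdot z (t%:C%C *: x) = t * rdot z x.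
Proof. by rewrite rdotC rdotZl rdotC. Qed.

Lemma rnorm_sqrD x y :
  rnorm (x + y) ^+ 2 = rnorm x ^+ 2 + 2 * rdot x y + rnorm y ^+ 2.
Proof.
rewrite -!rdot_self rdotDl !rdotDr (rdotC y x); ring.
Qed.

Lemma rnormZ t x : rnorm (t%:C%C *: x) = `|t| * rnorm x.
Proof.
apply/complexI; rewrite rnorm_complex normrZ normc_def /=.
by rewrite expr0n addr0 sqrtr_sqr -rnorm_complex rmorphM.
Qed.

(** The quadratic t |-> |x + t y|^2 is nonnegative; its value at the minimiser
    t = - <x, y> / |y|^2 is the inequality. *)
Lemma rdot_CauchySchwarz x y : rdot x y <= rnorm x * rnorm y.
Proof.
have quad t : 0 <= rnorm x ^+ 2 + 2 * t * rdot x y + t ^+ 2 * rnorm y ^+ 2.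
  have := sqr_ge0 (rnorm (x + t%:C%C *: y)).
  by rewrite rnorm_sqrD rdotZr rnormZ exprMn real_normK ?num_real// mulrA.
have [y0|y0] := eqVneq (rnorm y) 0.
  rewrite y0 mulr0.
  (* The quadratic is now affine in t, so a nonzero slope makes it negative. *)
  rewrite leNgt; apply/negP => d0.
  have := quad (- (rnorm x ^+ 2 + 1) / (2 * rdot x y)).
  rewrite y0 expr0n mulr0 addr0.
  rewrite mulrAC mulrCA divff ?mulr1; last by rewrite mulf_neq0// gt_eqF.
  lra.
have := quad (- rdot x y / rnorm y ^+ 2).
have -> : rnorm x ^+ 2 + 2 * (- rdot x y / rnorm y ^+ 2) * rdot x y +
   (- rdot x y / rnorm y ^+ 2) ^+ 2 * rnorm y ^+ 2 =
   (rnorm x ^+2 * rnorm y ^+ 2 - rdot x y ^+ 2) / rnorm y ^+ 2 by field.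
have yp : 0 < rnorm y ^+ 2 by rewrite exprn_gt0// lt_def y0 rnorm_ge0.
rewrite pmulr_lge0 ?invr_gt0// subr_ge0 -exprMn => h.
apply: (le_trans (ler_norm _)).
by rewrite -ler_sqr ?nnegrE ?mulr_ge0 ?rnorm_ge0// real_normK ?num_real.
Qed.


(** * Riesz representation *)

Lemma rnorm0 : rnorm (0 : V) = 0.
Proof. by rewrite /rnorm normr0. Qed.

Lemma rnormN x : rnorm (- x) = rnorm x.
Proof. by rewrite /rnorm normrN. Qed.

Lemma parallelogram x y :
  rnorm (x + y) ^+ 2 + rnorm (x - y) ^+ 2 =
  2 * rnorm x ^+ 2 + 2 * rnorm y ^+ 2.
Proof.
rewrite !rnorm_sqrD rnormN -[- y]scaleN1r.
have -> : -1 = (-1)%:C%C :> R[i] by rewrite rmorphN1.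
rewrite rdotZr; ring.
Qed.

(** Completeness, with the complex-valued norm replaced by the real one. *)
Lemma cauchy_seq_limit (u : nat -> V) :
  (forall e : R, 0 < e ->
     exists n, forall k, (n <= k)%N -> rnorm (u n - u k) < e) ->
  exists g, forall e : R, 0 < e ->
    exists n, forall k, (n <= k)%N -> rnorm (g - u k) < e.
Proof.
move=> uC.
have : cvg (u @ \oo).
  apply: cauchy_cvg; apply: cauchy_exP => e e0.
  have er : (complex.Re e)%:C%C = e by rewrite RRe_real// gtr0_real.
  have [|n un] := uC (complex.Re e); first by rewrite -ltcR er.
  exists (u n); exists n => // k /= nk.
  by rewrite -ball_normE /= -er -rnorm_complex ltcR un.
move=> /cvg_ex[g /cvgr_dist_lt ug]; exists g => e e0.
have e0' : 0 < e%:C%C by rewrite ltcR.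
have [n _ un] := ug _ e0'.
by exists n => k nk; have := un k nk; rewrite /= -rnorm_complex ltcR.
Qed.

(** Let J x = |x|^2 - 2 phi x, which is bounded below as phi is bounded. By the
    parallelogram identity a minimising sequence u of J is Cauchy. Its limit g
    satisfies the first variation inequality
    2 t (<x, g> - phi x) + t^2 |x|^2 >= 0 for all real t, which forces
    phi x = <x, g>. *)
Lemma riesz_real (phi : V -> R) (M : R) :
  (forall x y, phi (x + y) = phi x + phi y) ->
  (forall t x, phi (t%:C%C *: x) = t * phi x) ->
  (forall x, phi x <= M * rnorm x) ->
  exists g, forall x, phi x = rdot x g.
Proof.
move=> phiD phiZ phiM.
pose J x := rnorm x ^+ 2 - 2 * phi x.
have J_ge x : - M ^+ 2 <= J x.
  rewrite /J; have := phiM x; have := sqr_ge0 (rnorm x - M); nra.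
have hJ : has_inf (range J).
  by split; [exists (J 0), 0 | exists (- M ^+ 2) => _ [x _ <-]].
pose m := inf (range J).
have mJ x : m <= J x by apply: ge_inf; [exact: hJ.2 | exists x].
have /choice[u uJ] : forall n : nat, exists x, J x < m + n.+1%:R^-1.
  move=> n; have [] := @inf_adherent R (range J) n.+1%:R^-1 _ hJ => //.
  by move=> _ [x _ <-]; exists x.
have inv_small (e : R) : 0 < e -> exists n, n.+1%:R^-1 < e :> R.
  move=> e0; exists (Num.bound e^-1).
  rewrite invf_plt ?posrE//; apply: (lt_le_trans (archi_boundP _)).
    by rewrite invr_ge0 ltW.
  by rewrite ler_nat.
have inv_mono n k : (n <= k)%N -> k.+1%:R^-1 <= n.+1%:R^-1 :> R.
  by move=> nk; rewrite lef_pV2 ?posrE// ler_nat.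
have uC (e : R) : 0 < e ->
    exists n, forall k, (n <= k)%N -> rnorm (u n - u k) < e.
  move=> e0; have e40 : 0 < e ^+ 2 / 4 by rewrite divr_gt0 ?exprn_gt0.
  have [n ne] := inv_small _ e40.
  exists n => k nk; rewrite -ltr_sqr ?nnegrE ?rnorm_ge0 ?(ltW e0)//.
  (* |u n - u k|^2 = 2 J (u n) + 2 J (u k) - 4 J (midpoint), and J (midpoint)
     is at least m, so this is below 4 / n.+1. *)
  have := mJ ((2^-1)%:C%C *: (u n + u k)).
  have := uJ n; have := uJ k; have := inv_mono _ _ nk.
  have := parallelogram (u n) (u k).
  rewrite /J rnormZ phiZ phiD exprMn real_normK ?num_real//.
  move: n.+1%:R^-1 k.+1%:R^-1 ne => en ek; lra.
have [g gu] := cauchy_seq_limit uC.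
exists g => x.
pose d := rdot x g - phi x.
(* The variation is computed at u n, where J is within 1 / n.+1 of its infimum,
   and then compared with its value at the limit g; e' absorbs both errors. *)
have Jvar t : 0 <= 2 * t * d + t ^+ 2 * rnorm x ^+ 2.
  apply/ler_addgt0Pr => e e0.
  pose e' := e / (1 + 2 * `|t| * rnorm x).
  have D0 : 0 < 1 + 2 * `|t| * rnorm x.
    by rewrite ltr_pwDl// !mulr_ge0// rnorm_ge0.
  have e'0 : 0 < e' by rewrite divr_gt0.
  have [n1 n1e] := inv_small _ e'0; have [n2 n2e] := gu _ e'0.
  pose n := maxn n1 n2.
  have := n2e _ (leq_maxr n1 n2).
  have := le_lt_trans (inv_mono _ _ (leq_maxl n1 n2)) n1e.
  rewrite -/n => ne gne.
  have := mJ (u n + t%:C%C *: x); have := uJ n.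
  rewrite /J rnorm_sqrD rdotZr rnormZ phiD phiZ exprMn real_normK ?num_real//.
  have : t * rdot (u n) x <= t * rdot x g + `|t| * rnorm x * e'.
    rewrite -lerBlDl.
    have -> : t * rdot (u n) x - t * rdot x g
        = rdot ((- t)%:C%C *: x) (g - u n).
      rewrite rdotZl rdotDr -[- u n]scaleN1r.
      have -> : -1 = (-1)%:C%C :> R[i] by rewrite rmorphN1.
      rewrite rdotZr (rdotC (u n)); ring.
    apply: (le_trans (rdot_CauchySchwarz _ _)); rewrite rnormZ normrN.
    by rewrite ler_wpM2l ?mulr_ge0 ?rnorm_ge0// ltW.
  have : e = e' * (1 + 2 * `|t| * rnorm x) by rewrite /e' divfK ?gt_eqF.
  move: n.+1%:R^-1 ne => en; rewrite /d; lra.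
apply/eqP; rewrite eq_sym -subr_eq0 -/d; apply/eqP.
(* The optimal t would be - d / |x|^2; adding 1 avoids the case x = 0. *)
have N0 : 0 < rnorm x ^+ 2 + 1 by rewrite ltr_wpDl ?sqr_ge0.
have := Jvar (- d / (rnorm x ^+ 2 + 1)).
have -> : 2 * (- d / (rnorm x ^+ 2 + 1)) * d
   + (- d / (rnorm x ^+ 2 + 1)) ^+ 2 * rnorm x ^+ 2
   = - (d ^+ 2 * (rnorm x ^+ 2 + 2)) / (rnorm x ^+ 2 + 1) ^+ 2.
  by field; rewrite gt_eqF.
rewrite pmulr_lge0 ?invr_gt0 ?exprn_gt0// oppr_ge0.
rewrite pmulr_lle0; last by rewrite ltr_wpDl ?sqr_ge0.
by move=> d2; apply/eqP; rewrite -sqrf_eq0 eq_le d2 sqr_ge0.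
Qed.

End RealInner.
(** * Adjoints and operator norms *)

Section Operators.
Context {R : realType} {U V : hilbertType R}.
Implicit Type T : 'B(U, V).

Lemma bounded_op_le T : exists M : R, forall x, rnorm (T x) <= M * rnorm x.
Proof.
have [r r0 Tr] := pinfty_ex_gt0 ((linear_boundedP T).1 (bounded_opP T)).
have rE : (complex.Re r)%:C%C = r by rewrite RRe_real// gtr0_real.
exists (complex.Re r) => x.
by rewrite -lecR rmorphM /= !rnorm_complex rE.
Qed.

(** The adjoint is defined by choice; Riesz representation of u |-> <T u, v>
    shows that the choice is made in a nonempty set. *)
Lemma adjointP T x y : inner (T x) y = inner x (adjoint T y).
Proof.
suff : exists h : V -> U, forall x y, inner (T x) y = inner x (h y).
  by move=> /(xgetPex (fun=> 0)); exact.
have /choice[h hT] (v : V) : exists g : U, forall u, inner (T u) v = inner u g.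
  have [M TM] := bounded_op_le T.
  have [|||g gT] := @riesz_real R U (fun u => rdot (T u) v) (M * rnorm v).
  - by move=> u w; rewrite linearD rdotDl.
  - by move=> t u; rewrite linearZ rdotZl.
  - move=> u; apply: (le_trans (rdot_CauchySchwarz _ _)).
    by rewrite mulrAC ler_wpM2r ?rnorm_ge0.
  exists g => u; apply/eqP; rewrite eq_complex; apply/andP; split.
    exact/eqP/gT.
  (* Re (i z) = - Im z: the real identity at i u is the imaginary one at u. *)
  have := gT ('i%C *: u).
  rewrite /rdot linearZ !linearZl_LR /= ![_ * inner _ _]mulrC !ReiNIm.
  by move/oppr_inj/eqP.
by exists h => u v; exact: hT.
Qed.

Lemma inner_adjoint_self T x :
  inner (adjoint T (T x)) x = (rnorm (T x) ^+ 2)%:C%C.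
Proof.
rewrite hermC expr0 mul1r /= -adjointP inner_self.
by apply: geC0_conj; rewrite lecR sqr_ge0.
Qed.

Lemma rnorm_le_op_norm_unit T x : rnorm x <= 1 -> rnorm (T x) <= op_norm T.
Proof.
move=> x1; have [M TM] := bounded_op_le T.
apply: sup_upper_bound; last by exists x.
split; first by exists (rnorm (T x)), x.
exists `|M| => _ [z /= z1 <-].
apply: (le_trans (TM z)); apply: (le_trans (ler_norm _)).
by rewrite normrM (ger0_norm (rnorm_ge0 z)) ler_piMr.
Qed.

Lemma op_norm_ge0 T : 0 <= op_norm T.
Proof.
by apply: le_trans (rnorm_ge0 _) (@rnorm_le_op_norm_unit T 0 _); rewrite rnorm0.
Qed.

Lemma rnorm_le_op_norm T x : rnorm (T x) <= op_norm T * rnorm x.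
Proof.
have [x0|x0] := eqVneq (rnorm x) 0.
  have [M TM] := bounded_op_le T.
  by rewrite x0 mulr0; have := TM x; rewrite x0 mulr0.
have xp : 0 < rnorm x by rewrite lt_def x0 rnorm_ge0.
have xV : `|(rnorm x)^-1| = (rnorm x)^-1 by rewrite ger0_norm// invr_ge0 ltW.
have := @rnorm_le_op_norm_unit T ((rnorm x)^-1%:C%C *: x).
by rewrite linearZ !rnormZ xV mulVf// ler_pdivrMl// mulrC; apply.
Qed.

(** |T^* y|^2 = Re <T (T^* y), y> <= |T| |T^* y| |y|. *)
Lemma rnorm_adjoint_le T y : rnorm (adjoint T y) <= op_norm T * rnorm y.
Proof.
have [y0|y0] := eqVneq (rnorm (adjoint T y)) 0.
  by rewrite y0 mulr_ge0 ?rnorm_ge0 ?op_norm_ge0.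
have yp : 0 < rnorm (adjoint T y) by rewrite lt_def y0 rnorm_ge0.
rewrite -(ler_pM2l yp) -expr2 -rdot_self.
rewrite {1}/rdot -adjointP.
apply: (le_trans (rdot_CauchySchwarz _ _)).
by rewrite mulrCA mulrA ler_wpM2r ?rnorm_ge0 ?rnorm_le_op_norm.
Qed.

End Operators.

(** * Measurability of the norm *)

Section Measurability.
Context {R : realType} {d : measure_display} {Omega : measurableType d}.
Variables (H_ : Omega -> hilbertType R).

(** A test set for strong measurability that sees only the norm of a vector
    lying in a single summand. Asking for one large coordinate, rather than for
    a large norm in the direct sum, makes openness a matter of a single
    coordinate. *)
Lemma hdsum_open_coord_gt (c : R) :
  hdsum_open [set x : hdsum H_ | exists i, c < rnorm (sval x i)].
Proof.
move=> x [i xi]; exists (rnorm (sval x i) - c); first by rewrite subr_gt0.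
move=> y yx; exists i.
have coord : ((rnorm (sval y i - sval x i) ^+ 2)%:E
    <= sqnorm_sum (fun i => (sval y i - sval x i)%R))%E.
  apply: esum_ge; exists [set i]; first by split => //; exact: finite_set1.
  by rewrite fsbig_set1.
have := le_lt_trans coord yx.
rewrite lte_fin ltr_sqr ?nnegrE ?rnorm_ge0//; last by rewrite subr_ge0 ltW.
have : rnorm (sval x i) <= rnorm (sval y i) + rnorm (sval y i - sval x i).
  rewrite -lecR rmorphD /= !rnorm_complex distrC.
  by rewrite -{1}(subrKC (sval y i) (sval x i)) ler_normD.
lra.
Qed.

Lemma measurable_rnorm (F : forall w, H_ w) :
  strongly_measurable F -> measurable_fun setT (fun w => rnorm (F w)).
Proof.
move=> mF; apply: (measurability _ (RGenOInfty.measurableE R)) => //.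
move=> _ [_ [c ->] <-]; rewrite setTI.
have [c0|c0] := ltP c 0.
  rewrite (_ : _ @^-1` _ = setT)//; apply/seteqP; split => // w _ /=.
  by rewrite in_itv/= andbT (lt_le_trans c0)// rnorm_ge0.
have := mF _ (@hdsum_open_coord_gt c).
congr (measurable _); apply/seteqP; split => w /=; rewrite in_itv/= andbT.
  move=> [v]; rewrite /summand_fun.
  have [->|vw] := eqVneq v w; first by rewrite dfwithin.
  rewrite dfwithout 1?eq_sym// rnorm0 => /(le_lt_trans c0).
  by rewrite ltxx.
by move=> cF; exists w; rewrite /summand_fun dfwithin.
Qed.

End Measurability.

(** * Perturbation of an integral *)

(** Finiteness of the integral of q is a conclusion: it is at most the integral
    of p plus that of |p - q|, both finite. *)
Lemma integral_perturbation {R : realType} {d : measure_display}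
    {T : measurableType d} (mu : {measure set T -> \bar R})
    (p q : T -> R) (l1 l2 c : R) :
  measurable_fun setT p -> measurable_fun setT q ->
  (forall w, 0 <= p w) -> (forall w, 0 <= q w) ->
  (\int[mu]_w (p w)%:E < +oo)%E ->
  (\int[mu]_w (`|p w - q w|)%:E
     <= l1%:E * \int[mu]_w (p w)%:E + l2%:E * \int[mu]_w (q w)%:E + c%:E
     < +oo)%E ->
  exists a b : R, [/\ (\int[mu]_w (p w)%:E = a%:E)%E,
    (\int[mu]_w (q w)%:E = b%:E)%E,
    (1 - l1) * a - c <= (1 + l2) * b & (1 - l2) * b <= (1 + l1) * a + c].
Proof.
move=> mp mq p0 q0 pfin /andP[pq_le rhs_fin].
have mpE : measurable_fun setT (fun w => (p w)%:E) by exact/measurable_EFinP.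
have mqE : measurable_fun setT (fun w => (q w)%:E) by exact/measurable_EFinP.
have mpq : measurable_fun setT (fun w => (`|p w - q w|)%:E).
  apply/measurable_EFinP; apply: measurableT_comp => //.
  exact: measurable_funB.
have triangle (f g : T -> R) : measurable_fun setT (fun w => (f w)%:E) ->
    measurable_fun setT (fun w => (g w)%:E) ->
    (forall w, 0 <= f w) -> (forall w, 0 <= g w) ->
    (forall w, g w <= `|p w - q w| + f w) ->
    (\int[mu]_w (g w)%:E
       <= \int[mu]_w (`|p w - q w|)%:E + \int[mu]_w (f w)%:E)%E.
  move=> mf mg f0 g0 gf; rewrite -ge0_integralD//.
  - apply: ge0_le_integral => //.
    + by move=> w _; rewrite lee_fin.
    + exact: emeasurable_funD.
    + by move=> w _; rewrite -EFinD lee_fin.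
  - by move=> w _; rewrite lee_fin.
have qp : (\int[mu]_w (q w)%:E
    <= \int[mu]_w (`|p w - q w|)%:E + \int[mu]_w (p w)%:E)%E.
  by apply: triangle => // w; rewrite -lerBlDr distrC ler_norm.
have pq : (\int[mu]_w (p w)%:E
    <= \int[mu]_w (`|p w - q w|)%:E + \int[mu]_w (q w)%:E)%E.
  by apply: triangle => // w; rewrite -lerBlDr ler_norm.
have I0 (f : T -> R) : (forall w, 0 <= f w) -> (0 <= \int[mu]_w (f w)%:E)%E.
  by move=> f0; apply: integral_ge0 => w _; rewrite lee_fin.
have pf : (\int[mu]_w (p w)%:E \is a fin_num)%E by rewrite ge0_fin_numE ?I0.
have df : (\int[mu]_w (`|p w - q w|)%:E \is a fin_num)%E.
  by rewrite ge0_fin_numE ?I0// (le_lt_trans pq_le).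
have qf : (\int[mu]_w (q w)%:E \is a fin_num)%E.
  rewrite ge0_fin_numE ?I0//; apply: (le_lt_trans qp).
  by rewrite lte_add_pinfty// -ge0_fin_numE ?I0.
exists (fine (\int[mu]_w (p w)%:E)), (fine (\int[mu]_w (q w)%:E)).
move: pq_le qp pq.
rewrite -(fineK pf) -(fineK qf) -(fineK df) -!EFinM -!EFinD !lee_fin /=.
by move=> pq_le qp pq; split => //; lra.
Qed.

(** * The perturbed frame *)

Theorem theorem4p1 (R : realType) (d : measure_display)
    (Omega : measurableType d) (mu : {measure set Omega -> \bar R})
    (H : hilbertType R) (H_ : Omega -> hilbertType R)
    (K : 'B(H, H)) (L G : forall w : Omega, 'B(H, H_ w))
    (A B lambda1 lambda2 gamma : R) :
  separable_space H ->
  c_K_g_frame mu K L A B ->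
  (forall f : H, strongly_measurable (fun w => G w f)) ->
  0 <= lambda1 -> 0 <= lambda2 -> 0 <= gamma ->
  Num.max lambda2 (gamma / A + lambda1) < 1 ->
  (* The last bound says that the inequality is between finite quantities. With
     both sides infinite it would be void, and the conclusion false. *)
  (forall f g : H,
    (\int[mu]_w (rnorm (inner (adjoint (L w) (L w f)
                               - adjoint (G w) (G w f)) g))%:E
     <= lambda1%:E * \int[mu]_w (rnorm (inner (adjoint (L w) (L w f)) g))%:E
        + lambda2%:E * \int[mu]_w (rnorm (inner (adjoint (G w) (G w f)) g))%:E
        + (gamma * rnorm (adjoint K f) ^+ 2)%:E
     < +oo)%E) ->
  c_K_g_frame mu K G
    (((1 - lambda1) * A - gamma) / (1 + lambda2))
    (((1 + lambda1) * B + gamma * op_norm K ^+ 2) / (1 - lambda2)).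
Proof.
move=> _ [mL A0 AB LAB] mG l10 l20 g0; rewrite gt_max => /andP[l21 gA1] pert.
have gA : gamma < (1 - lambda1) * A by rewrite -ltr_pdivrMr// ltrBrDr.
have l11 : lambda1 < 1.
  by rewrite (le_lt_trans _ gA1)// lerDr divr_ge0// ltW.
have l2D : 0 < 1 + lambda2 by rewrite ltr_pwDl.
have l2B : 0 < 1 - lambda2 by rewrite subr_gt0.
have rnorm_real (r : R) : rnorm (r%:C%C : R[i]) = `|r|.
  by rewrite /rnorm normc_def /= expr0n addr0 sqrtr_sqr.
split => //.
- by rewrite divr_gt0// subr_gt0.
- apply: (@le_trans _ _ A); first by rewrite ler_pdivrMr//; nra.
  apply: (le_trans AB); rewrite ler_pdivlMr//.
  have := mulr_ge0 g0 (sqr_ge0 (op_norm K)).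
  have B0 : 0 < B by exact: lt_le_trans AB.
  by have := mulr_ge0 l10 (ltW B0); have := mulr_ge0 l20 (ltW B0); lra.
move=> f; have /andP[LA LB] := LAB f.
have := pert f f.
have sqE (T : forall w, 'B(H, H_ w)) w :
    rnorm (inner (adjoint (T w) (T w f)) f) = rnorm (T w f) ^+ 2.
  by rewrite inner_adjoint_self rnorm_real ger0_norm ?sqr_ge0.
have diffE w : rnorm (inner (adjoint (L w) (L w f) - adjoint (G w) (G w f)) f)
    = `|rnorm (L w f) ^+ 2 - rnorm (G w f) ^+ 2|.
  by rewrite innerBl !inner_adjoint_self -rmorphB rnorm_real.
rewrite (eq_integral _ _ (fun w _ => congr1 EFin (diffE w))).
rewrite (eq_integral _ _ (fun w _ => congr1 EFin (sqE L w))).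
rewrite (eq_integral _ _ (fun w _ => congr1 EFin (sqE G w))).
move=> /integral_perturbation[||w|w||a [b [aE bE lo up]]].
- exact/measurable_funX/measurable_rnorm.
- exact/measurable_funX/measurable_rnorm.
- exact: sqr_ge0.
- exact: sqr_ge0.
- by rewrite (le_lt_trans LB)// ltry.
move: LA LB; rewrite aE bE !lee_fin => LA LB.
apply/andP; split.
  rewrite mulrAC ler_pdivrMr// [b * _]mulrC; apply: le_trans lo.
  have := ler_wpM2l (_ : 0 <= 1 - lambda1) LA.
  rewrite subr_ge0 (ltW l11) => /(_ isT).
  lra.
rewrite mulrAC ler_pdivlMr// [b * _]mulrC; apply: (le_trans up).
have Kf : rnorm (adjoint K f) ^+ 2 <= op_norm K ^+ 2 * rnorm f ^+ 2.
  rewrite -exprMn ler_sqr ?nnegrE ?rnorm_ge0 ?rnorm_adjoint_le//.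
  exact: le_trans (rnorm_ge0 _) (rnorm_adjoint_le _ _).
have := ler_wpM2l g0 Kf.
have := ler_wpM2l (_ : 0 <= 1 + lambda1) LB; rewrite addr_ge0// => /(_ isT).
lra.
Qed.
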